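(* Let $\vec\alpha(s)$ be a unit speed rectifying spacelike curve in $E_1^4$, with non-zero curvatures $\kappa_1(s)$, $\kappa_2(s)$ and $\kappa_3(s)$. Then the following statements hold: (i) The distance function $\rho(s)=\|\vec\alpha(s)\|$ satisfies $\rho^2(s)=s^2+c_1s+c_2$ for some $c_1\in\mathbb{R}$ and $c_2\in\mathbb{R}$. (ii) The tangential component of the position vector of the curve is given by $g(\vec\alpha(s),\vec T(s))=s+c$ for some $c\in\mathbb{R}$. (iii) The normal component $\vec\alpha^{N}(s)$ of the position vector of the curve has constant length and the distance function $\rho(s)=\|\vec\alpha(s)\|$ is non-constant. (iv) The first binormal component and the second binormal component of the position vector of the curve are respectively given by $$g(\vec\alpha(s),\vec B_1(s))=\varepsilon\Big(A\cosh\int_0^s\kappa_3(u)\,du+B\sinh\int_0^s\kappa_3(u)\,du\Big),$$ $$g(\vec\alpha(s),\vec B_2(s))=\varepsilon\Big(A\sinh\int_0^s\kappa_3(u)\,du+B\cosh\int_0^s\kappa_3(u)\,du\Big)$$ for some constants $A,B\in\mathbb{R}$. Conversely, if $\vec\alpha(s)$ is a unit speed curve in $E_1^4$ with non-zero curvatures $\kappa_1(s)$, $\kappa_2(s)$ and $\kappa_3(s)$ and one of the statements (i), (ii), (iii) or (iv) holds, then $\vec\alpha(s)$ is a rectifying spacelike curve.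
   Context: $E_1^4$ (Minkowski space-time) is $\mathbb{R}^4$ with the pseudo scalar product $g(\vec v,\vec w)=-v_1w_1+v_2w_2+v_3w_3+v_4w_4$. A vector $\vec v$ is spacelike if $g(\vec v,\vec v)>0$ or $\vec v=0$, timelike if $g(\vec v,\vec v)<0$, and null if $g(\vec v,\vec v)=0$ and $\vec v\neq 0$. The pseudo-norm (length) of $\vec v$ is $\|\vec v\|=\sqrt{|g(\vec v,\vec v)|}$. A curve $\vec\alpha:I\subset\mathbb{R}\to E_1^4$ is spacelike if all its velocity vectors $\vec\alpha'(s)$ are spacelike, and it is unit speed (parameterized by arclength $s$) if $g(\vec\alpha',\vec\alpha')=\pm1$. $\{\vec T,\vec N,\vec B_1,\vec B_2\}$ denotes the moving Frenet frame along the curve (tangent, principal normal, first binormal, second binormal). For a spacelike curve with spacelike principal normal, these mutually orthogonal fields satisfy $g(\vec T,\vec T)=g(\vec N,\vec N)=1$, $g(\vec B_1,\vec B_1)=-g(\vec B_2,\vec B_2)=\varepsilon=\pm1$, and the Frenet equations $$\vec T'=\kappa_1\vec N,\quad \vec N'=-\kappa_1\vec T+\kappa_2\vec B_1,\quad \vec B_1'=-\varepsilon\kappa_2\vec N+\kappa_3\vec B_2,\quad \vec B_2'=\kappa_3\vec B_1,$$ where $\kappa_1,\kappa_2,\kappa_3$ are called the first, second and third curvatures. The frame, the sign $\varepsilon$ and the curvatures in the claim are those appearing in these equations. The curve is called rectifying if its position vector (with respect to some chosen origin) always lies in the orthogonal complement of its principal normal $\vec N$, i.e. $g(\vec\alpha(s),\vec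 N(s))=0$ for all $s$; equivalently $\vec\alpha=\lambda\vec T+\mu\vec B_1+\nu\vec B_2$ for some differentiable functions $\lambda,\mu,\nu$ of $s$. The normal component $\vec\alpha^{N}$ of the position vector is defined by the decomposition $\vec\alpha(s)=m(s)\vec T(s)+\vec\alpha^{N}(s)$ with $m(s)=g(\vec\alpha(s),\vec T(s))$.
   Formalization: In (i), in both directions, ρ² is replaced by sign(g(α,α))·ρ², i.e. g(α,α) = s²+c₁s+c₂; the printed formula fails when the position vector is timelike (a rectifying curve can have g(α,α) = s²−1, so ρ² = 1−s² for |s|<1). *)

(* Defs.v *)
From Stdlib Require Import Reals.
From Coquelicot Require Import Coquelicot.
Open Scope R_scope.

Definition E14 : NormedModule R_AbsRing :=
  prod_NormedModule R_AbsRing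
    (prod_NormedModule R_AbsRing
      (prod_NormedModule R_AbsRing R_NormedModule R_NormedModule)
      R_NormedModule)
    R_NormedModule.

Definition g (v w : E14) : R :=
  let '(v1, v2, v3, v4) := v in
  let '(w1, w2, w3, w4) := w in
  - (v1 * w1) + v2 * w2 + v3 * w3 + v4 * w4.

Definition spacelike (v : E14) : Prop := 0 < g v v \/ v = zero.

Definition pnorm (v : E14) : R := sqrt (Rabs (g v v)).

(* The parameter interval I is the open interval (a, b), possibly unbounded. *)
Definition in_itv (a b : Rbar) (s : R) : Prop := Rbar_lt a s /\ Rbar_lt s b.

Definition spacelike_curve (a b : Rbar) (alpha : R -> E14) : Prop :=
  forall s, in_itv a b s -> exists v, is_derive alpha s v /\ spacelike v.

Definition unit_speed (a b : Rbar) (alpha : R -> E14) : Prop :=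
  forall s, in_itv a b s ->
    exists v, is_derive alpha s v /\ (g v v = 1 \/ g v v = -1).

(* Frenet apparatus of a spacelike curve with spacelike principal normal.
   Continuity of the curvatures is the only regularity required of them; it
   holds as soon as the curve is of class C^4. *)
Record frenet (a b : Rbar) (alpha T N B1 B2 : R -> E14) (eps : R)
    (k1 k2 k3 : R -> R) : Prop := {
  frenet_eps : eps = 1 \/ eps = -1;
  frenet_alpha : forall s, in_itv a b s -> is_derive alpha s (T s);
  frenet_T : forall s, in_itv a b s -> is_derive T s (scal (k1 s) (N s));
  frenet_N : forall s, in_itv a b s ->
    is_derive N s (plus (scal (- k1 s) (T s)) (scal (k2 s) (B1 s)));
  frenet_B1 : forall s, in_itv a b s ->
    is_derive B1 s (plus (scal (- eps * k2 s) (N s)) (scal (k3 s) (B2 s)));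
  frenet_B2 : forall s, in_itv a b s -> is_derive B2 s (scal (k3 s) (B1 s));
  frenet_gTT : forall s, in_itv a b s -> g (T s) (T s) = 1;
  frenet_gNN : forall s, in_itv a b s -> g (N s) (N s) = 1;
  frenet_gB1B1 : forall s, in_itv a b s -> g (B1 s) (B1 s) = eps;
  frenet_gB2B2 : forall s, in_itv a b s -> g (B2 s) (B2 s) = - eps;
  frenet_gTN : forall s, in_itv a b s -> g (T s) (N s) = 0;
  frenet_gTB1 : forall s, in_itv a b s -> g (T s) (B1 s) = 0;
  frenet_gTB2 : forall s, in_itv a b s -> g (T s) (B2 s) = 0;
  frenet_gNB1 : forall s, in_itv a b s -> g (N s) (B1 s) = 0;
  frenet_gNB2 : forall s, in_itv a b s -> g (N s) (B2 s) = 0;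
  frenet_gB1B2 : forall s, in_itv a b s -> g (B1 s) (B2 s) = 0;
  frenet_k1 : forall s, in_itv a b s -> continuous k1 s;
  frenet_k2 : forall s, in_itv a b s -> continuous k2 s;
  frenet_k3 : forall s, in_itv a b s -> continuous k3 s
}.

(* [alpha s] is the position vector: the chosen origin is the zero vector. *)
Definition rectifying (a b : Rbar) (alpha N : R -> E14) : Prop :=
  forall s, in_itv a b s -> g (alpha s) (N s) = 0.

Definition normal_component (alpha T : R -> E14) (s : R) : E14 :=
  minus (alpha s) (scal (g (alpha s) (T s)) (T s)).

Definition constant_on (a b : Rbar) (f : R -> R) : Prop :=
  exists c, forall s, in_itv a b s -> f s = c.

(* The square of the distance function carries the sign of g(alpha, alpha): it
   is the squared pseudo-norm wherever the position vector is not timelike.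
   Since the pseudo-norm takes an absolute value, the sign is lost in the bare
   square; for y a unit-speed helix in the hyperbolic space g(y, y) = -1, the
   curve y / cosh with s = tanh is rectifying and rho^2 = 1 - s^2. *)
Definition distance_formula (a b : Rbar) (alpha : R -> E14) : Prop :=
  exists c1 c2, forall s, in_itv a b s ->
    sign (g (alpha s) (alpha s)) * pnorm (alpha s) ^ 2 = s ^ 2 + c1 * s + c2.

Definition tangential_formula (a b : Rbar) (alpha T : R -> E14) : Prop :=
  exists c, forall s, in_itv a b s -> g (alpha s) (T s) = s + c.

Definition normal_length_condition (a b : Rbar) (alpha T : R -> E14) : Prop :=
  constant_on a b (fun s => pnorm (normal_component alpha T s)) /\
  ~ constant_on a b (fun s => pnorm (alpha s)).

(* Meaningful only when 0 lies in (a, b). *)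
Definition binormal_formulas (a b : Rbar) (alpha B1 B2 : R -> E14) (eps : R)
    (k3 : R -> R) : Prop :=
  exists A B, forall s, in_itv a b s ->
    g (alpha s) (B1 s)
      = eps * (A * cosh (RInt k3 0 s) + B * sinh (RInt k3 0 s)) /\
    g (alpha s) (B2 s)
      = eps * (A * sinh (RInt k3 0 s) + B * cosh (RInt k3 0 s)).

(* Main.v *)
(* Let t, n, b1, b2 be the products of alpha with T, N, B1, B2 and q = g(alpha, alpha).
   The Frenet equations give q' = 2 t, t' = 1 + k1 n, b1' = - eps k2 n + k3 b2 and
   b2' = k3 b1, and each of the four statements is read off from n = 0.  Conversely,
   (i) and (ii) force t' = 1, and (iv) forces b1' = k3 b2, hence n = 0.  In (iii) the
   constancy of |q - t^2| gives t n = 0, so the continuous function t' only takes the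
   values 0 and 1; were it 0, t would vanish and q, hence rho, would be constant. *)
Require Import Defs.
From Stdlib Require Import Reals Lra.
From Coquelicot Require Import Coquelicot.
Open Scope R_scope.

(** * Algebra and differentiation of the pseudo scalar product *)

Lemma is_derive_eq (f : R -> R) (s l l' : R) :
  is_derive f s l -> l = l' -> is_derive f s l'.
Proof.
  intros H <-; exact H.
Qed.

(** A projection is continuous and linear, hence its own differential, so the chain rule applies.
    This serves to reach the coordinates of [E14], a nested product. *)
Lemma is_derive_fst (U V : NormedModule R_AbsRing)
    (f : R -> prod_NormedModule R_AbsRing U V) (s : R)
    (l : prod_NormedModule R_AbsRing U V) :
  is_derive f s l -> is_derive (fun u => fst (f u) : U) s (fst l).
Proof.
  intros H.
  apply (filterdiff_ext_lin _ (fun y : R => fst (scal y l))); [| reflexivity].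
  apply (filterdiff_comp' f (fun p => fst p) s _ (fun p => fst p)).
  - exact H.
  - apply filterdiff_linear, is_linear_fst.
Qed.

Lemma is_derive_snd (U V : NormedModule R_AbsRing)
    (f : R -> prod_NormedModule R_AbsRing U V) (s : R)
    (l : prod_NormedModule R_AbsRing U V) :
  is_derive f s l -> is_derive (fun u => snd (f u) : V) s (snd l).
Proof.
  intros H.
  apply (filterdiff_ext_lin _ (fun y : R => snd (scal y l))); [| reflexivity].
  apply (filterdiff_comp' f (fun p => snd p) s _ (fun p => snd p)).
  - exact H.
  - apply filterdiff_linear, is_linear_snd.
Qed.

Lemma g_sym (v w : E14) : g v w = g w v.
Proof.
  destruct v as [[[v1 v2] v3] v4], w as [[[w1 w2] w3] w4]; simpl; ring.
Qed.

Lemma g_plus_r (u v w : E14) : g u (plus v w) = g u v + g u w.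
Proof.
  destruct u as [[[u1 u2] u3] u4], v as [[[v1 v2] v3] v4],
    w as [[[w1 w2] w3] w4].
  unfold plus; simpl; unfold plus; simpl; ring.
Qed.

Lemma g_scal_r (c : R) (v w : E14) : g v (scal c w) = c * g v w.
Proof.
  destruct v as [[[v1 v2] v3] v4], w as [[[w1 w2] w3] w4].
  unfold scal; simpl; unfold scal; simpl; unfold mult; simpl; ring.
Qed.

(** Pythagoras: removing the projection onto a unit vector lowers the squared length by the square
    of the coefficient. *)
Lemma g_normal_component (alpha T : R -> E14) (s : R) :
  g (T s) (T s) = 1 ->
  g (normal_component alpha T s) (normal_component alpha T s)
    = g (alpha s) (alpha s) - g (alpha s) (T s) ^ 2.
Proof.
  unfold normal_component; generalize (alpha s) (T s); intros v w H.
  (* With an arbitrary coefficient [c] the expansion is a polynomial identity of low degree in the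
     coordinates; [c = g v w] is substituted afterwards. *)
  assert (E : forall c, g (minus v (scal c w)) (minus v (scal c w))
    = g v v - 2 * c * g v w + c ^ 2 * g w w).
  { clear H; intros c.
    destruct v as [[[v1 v2] v3] v4], w as [[[w1 w2] w3] w4].
    unfold minus, plus, opp, scal; simpl; unfold plus, opp, scal; simpl.
    unfold plus, opp, scal; simpl; unfold mult; simpl; ring. }
  rewrite E, H; ring.
Qed.

(** [g] is a signed sum of products of coordinates: the nested pairs are peeled off one level at a
    time and the product rule is applied to each of the four terms. *)
Lemma is_derive_g (v w : R -> E14) (s : R) (dv dw : E14) :
  is_derive v s dv -> is_derive w s dw ->
  is_derive (fun u => g (v u) (w u)) s (g dv (w s) + g (v s) dw).
Proof.
  intros Hv Hw.
  apply (is_derive_ext (fun u =>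
    - (fst (fst (fst (v u))) * fst (fst (fst (w u))))
    + snd (fst (fst (v u))) * snd (fst (fst (w u)))
    + snd (fst (v u)) * snd (fst (w u)) + snd (v u) * snd (w u))).
  { intros u; destruct (v u) as [[[? ?] ?] ?], (w u) as [[[? ?] ?] ?].
    reflexivity. }
  pose proof (is_derive_snd _ _ _ _ _ Hv) as V4.
  pose proof (is_derive_snd _ _ _ _ _ Hw) as W4.
  apply is_derive_fst in Hv; apply is_derive_fst in Hw.
  pose proof (is_derive_snd _ _ _ _ _ Hv) as V3.
  pose proof (is_derive_snd _ _ _ _ _ Hw) as W3.
  apply is_derive_fst in Hv; apply is_derive_fst in Hw.
  pose proof (is_derive_snd _ _ _ _ _ Hv) as V2.
  pose proof (is_derive_snd _ _ _ _ _ Hw) as W2.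
  pose proof (is_derive_fst _ _ _ _ _ Hv) as V1.
  pose proof (is_derive_fst _ _ _ _ _ Hw) as W1.
  pose proof (is_derive_mult _ _ _ _ _ V1 W1 Rmult_comm) as D1.
  pose proof (is_derive_mult _ _ _ _ _ V2 W2 Rmult_comm) as D2.
  pose proof (is_derive_mult _ _ _ _ _ V3 W3 Rmult_comm) as D3.
  pose proof (is_derive_mult _ _ _ _ _ V4 W4 Rmult_comm) as D4.
  pose proof (is_derive_plus _ _ _ _ _
    (is_derive_plus _ _ _ _ _
      (is_derive_plus _ _ _ _ _ (is_derive_opp _ _ _ D1) D2) D3) D4) as D.
  apply (is_derive_eq _ _ _ _ D); clear.
  destruct (v s) as [[[? ?] ?] ?], (w s) as [[[? ?] ?] ?],
    dv as [[[? ?] ?] ?], dw as [[[? ?] ?] ?].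
  unfold plus, opp, mult; simpl; unfold plus, mult; simpl; ring.
Qed.

(** * Open intervals and functions controlled there by their derivatives *)

Lemma in_itv_nonempty (a b : Rbar) : Rbar_lt a b -> exists s, in_itv a b s.
Proof.
  unfold in_itv; destruct a as [a | |], b as [b | |]; simpl; intros H;
    try contradiction.
  - exists ((a + b) / 2); lra.
  - exists (a + 1); lra.
  - exists (b - 1); lra.
  - exists 0; tauto.
Qed.

Lemma in_itv_between (a b : Rbar) (x y z : R) :
  in_itv a b x -> in_itv a b y -> x <= z <= y -> in_itv a b z.
Proof.
  unfold in_itv; destruct a, b; simpl; intros; split; trivial; lra.
Qed.

Lemma in_itv_between_minmax (a b : Rbar) (x y z : R) :
  in_itv a b x -> in_itv a b y -> Rmin x y <= z <= Rmax x y -> in_itv a b z.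
Proof.
  intros Hx Hy; destruct (Rle_dec x y).
  - rewrite Rmin_left, Rmax_right by lra; now apply in_itv_between.
  - rewrite Rmin_right, Rmax_left by lra; now apply in_itv_between.
Qed.

Lemma in_itv_open (a b : Rbar) (s : R) :
  in_itv a b s -> locally s (in_itv a b).
Proof.
  intros [H1 H2]; apply filter_and.
  - now apply open_Rbar_gt.
  - now apply open_Rbar_lt.
Qed.

(** The interval is open, so [f] and [h] agree near [s], and derivatives are unique. *)
Lemma derivative_eq_on (a b : Rbar) (f h : R -> R) (s l l' : R) :
  in_itv a b s -> (forall u, in_itv a b u -> f u = h u) ->
  is_derive f s l -> is_derive h s l' -> l = l'.
Proof.
  intros Hs E Hf Hh.
  rewrite <- (is_derive_unique _ _ _ Hf); apply is_derive_unique.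
  apply (is_derive_ext_loc h); trivial.
  apply (filter_imp (in_itv a b)); [| now apply in_itv_open].
  intros u Hu; symmetry; now apply E.
Qed.

Lemma derivative_0_eq (a b : Rbar) (f : R -> R) (x y : R) :
  (forall s, in_itv a b s -> is_derive f s 0) ->
  in_itv a b x -> in_itv a b y -> f x = f y.
Proof.
  intros H Hx Hy.
  destruct (Rtotal_order x y) as [L | [-> | L]]; trivial; [| symmetry];
    apply (eq_is_derive f); trivial; intros s Hs; apply H.
  - now apply (in_itv_between a b x y).
  - now apply (in_itv_between a b y x).
Qed.

Lemma derivative_0_constant (a b : Rbar) (f : R -> R) :
  Rbar_lt a b -> (forall s, in_itv a b s -> is_derive f s 0) ->
  constant_on a b f.
Proof.
  intros hab H; destruct (in_itv_nonempty _ _ hab) as [s0 H0].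
  exists (f s0); intros s Hs; now apply (derivative_0_eq a b f).
Qed.

(** If the constant is 0, then [f] vanishes identically. Otherwise [f] has no zero, and
    differentiating the constant function [f ^ 2] gives [2 * f * df = 0]. *)
Lemma derivative_0_of_constant_abs (a b : Rbar) (f df : R -> R) :
  (forall s, in_itv a b s -> is_derive f s (df s)) ->
  constant_on a b (fun s => Rabs (f s)) ->
  forall s, in_itv a b s -> df s = 0.
Proof.
  intros H [d Hd] s Hs.
  destruct (Req_dec d 0) as [-> | Hd0].
  - apply (derivative_eq_on a b f (fun _ => 0) s); auto.
    + intros u Hu; specialize (Hd u Hu); simpl in Hd.
      destruct (Req_dec (f u) 0) as [| Hn]; trivial.
      exfalso; exact (Rabs_no_R0 _ Hn Hd).
    + apply @is_derive_const.
  - assert (E : df s * f s + f s * df s = 0).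
    { apply (derivative_eq_on a b (fun u => f u * f u) (fun _ => d ^ 2) s);
        trivial.
      - intros u Hu; rewrite <- (Hd u Hu), pow2_abs; ring.
      - exact (is_derive_mult f f s _ _ (H s Hs) (H s Hs) Rmult_comm).
      - apply @is_derive_const. }
    assert (Hf : f s <> 0).
    { intros Z; apply Hd0; rewrite <- (Hd s Hs), Z; apply Rabs_R0. }
    apply (Rmult_eq_reg_l (2 * f s)); lra.
Qed.

(** If both values 0 and 1 occurred, the intermediate value theorem would produce the value 1/2. *)
Lemma continuous_boolean_constant (a b : Rbar) (f : R -> R) :
  (forall s, in_itv a b s -> continuous f s) ->
  (forall s, in_itv a b s -> f s = 0 \/ f s = 1) ->
  forall x y, in_itv a b x -> in_itv a b y -> f x = f y.
Proof.
  intros Hc.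
  assert (key : forall h : R -> R,
    (forall s, in_itv a b s -> continuous h s) ->
    forall x y, in_itv a b x -> in_itv a b y -> x < y -> h x = 0 -> h y = 1 ->
    exists z, in_itv a b z /\ h z = 1 / 2).
  { intros h Hh x y Hx Hy L E0 E1.
    assert (Hp : forall z, x <= z <= y -> continuity_pt h z).
    { intros z Hz; apply continuity_pt_filterlim, Hh.
      now apply (in_itv_between a b x y). }
    destruct (IVT_Rbar_incr h x y (h x) (h y) (1 / 2)) as [z [Z1 [Z2 Z3]]].
    - apply is_lim_continuity, Hp; lra.
    - apply is_lim_continuity, Hp; lra.
    - simpl; intros; apply Hp; lra.
    - exact L.
    - simpl; lra.
    - exists z; split; trivial; simpl in *.
      apply (in_itv_between a b x y); trivial; lra. }
  assert (key' : forall x y, (forall s, in_itv a b s -> f s = 0 \/ f s = 1) ->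
    in_itv a b x -> in_itv a b y -> x < y -> f x = f y).
  { intros x y Hb Hx Hy L.
    destruct (Hb x Hx) as [Ex | Ex], (Hb y Hy) as [Ey | Ey]; try congruence.
    - destruct (key f Hc x y) as [z [Hz Ez]]; trivial.
      destruct (Hb z Hz); lra.
    (* A descent from 1 to 0 is a rise from 0 to 1 for [1 - f]. *)
    - destruct (key (fun u => 1 - f u)) with (x := x) (y := y) as [z [Hz Ez]];
        trivial; try lra.
      + intros s Hs; apply @continuous_minus; [apply continuous_const | auto].
      + destruct (Hb z Hz); lra. }
  intros Hb x y Hx Hy.
  destruct (Rtotal_order x y) as [L | [-> | L]]; trivial; [| symmetry]; auto.
Qed.

(** * The primitive of the third curvature and hyperbolic functions *)

Lemma is_derive_primitive (a b : Rbar) (k : R -> R) (s : R) :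
  (forall u, in_itv a b u -> continuous k u) ->
  in_itv a b 0 -> in_itv a b s -> is_derive (RInt k 0) s (k s).
Proof.
  intros Hk H0 Hs; apply (is_derive_RInt k (RInt k 0) 0); [| auto].
  apply (filter_imp (in_itv a b)); [| now apply in_itv_open].
  intros u Hu; apply @RInt_correct, ex_RInt_continuous.
  intros z Hz; apply Hk; now apply (in_itv_between_minmax a b 0 u).
Qed.

Lemma is_derive_cosh_comp (f : R -> R) (s l : R) :
  is_derive f s l -> is_derive (fun u => cosh (f u)) s (l * sinh (f s)).
Proof.
  intros H; apply (is_derive_comp cosh f s (sinh (f s)) l); trivial.
  apply is_derive_Reals, derivable_pt_lim_cosh.
Qed.

Lemma is_derive_sinh_comp (f : R -> R) (s l : R) :
  is_derive f s l -> is_derive (fun u => sinh (f u)) s (l * cosh (f s)).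
Proof.
  intros H; apply (is_derive_comp sinh f s (cosh (f s)) l); trivial.
  apply is_derive_Reals, derivable_pt_lim_sinh.
Qed.

Lemma cosh2_minus_sinh2 (x : R) : cosh x * cosh x - sinh x * sinh x = 1.
Proof.
  unfold cosh, sinh.
  assert (E : exp x * exp (- x) = 1)
    by (rewrite <- exp_plus, Rplus_opp_r; apply exp_0).
  lra.
Qed.

(** * Signs and pseudo-norms *)

Lemma sign_mult_abs (x : R) : sign x * Rabs x = x.
Proof.
  destruct (Rtotal_order x 0) as [H | [-> | H]].
  - rewrite sign_eq_m1, Rabs_left by lra; ring.
  - rewrite Rabs_R0; ring.
  - rewrite sign_eq_1, Rabs_pos_eq by lra; ring.
Qed.

Lemma pnorm_sqr (v : E14) : pnorm v ^ 2 = Rabs (g v v).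
Proof.
  unfold pnorm; apply pow2_sqrt, Rabs_pos.
Qed.

(** Squaring and taking roots pass between the two. This removes the square root before
    differentiating. *)
Lemma constant_pnorm_iff (a b : Rbar) (v : R -> E14) :
  constant_on a b (fun s => pnorm (v s)) <->
  constant_on a b (fun s => Rabs (g (v s) (v s))).
Proof.
  split; intros [c Hc].
  - exists (c ^ 2); intros s Hs; now rewrite <- pnorm_sqr, (Hc s Hs).
  - exists (sqrt c); intros s Hs; unfold pnorm; now rewrite (Hc s Hs).
Qed.

Theorem theorem3p3 (a b : Rbar) (alpha T N B1 B2 : R -> E14) (eps : R)
    (k1 k2 k3 : R -> R)
    (hab : Rbar_lt a b)
    (hunit : unit_speed a b alpha)
    (hfrenet : frenet a b alpha T N B1 B2 eps k1 k2 k3)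
    (hk1 : forall s, in_itv a b s -> k1 s <> 0)
    (hk2 : forall s, in_itv a b s -> k2 s <> 0)
    (hk3 : forall s, in_itv a b s -> k3 s <> 0) :
  (rectifying a b alpha N -> spacelike_curve a b alpha ->
     distance_formula a b alpha /\
     tangential_formula a b alpha T /\
     normal_length_condition a b alpha T /\
     (in_itv a b 0 -> binormal_formulas a b alpha B1 B2 eps k3)) /\
  (distance_formula a b alpha \/
   tangential_formula a b alpha T \/
   normal_length_condition a b alpha T \/
   (in_itv a b 0 /\ binormal_formulas a b alpha B1 B2 eps k3) ->
     rectifying a b alpha N /\ spacelike_curve a b alpha).
Proof.

  (* Derivatives of the components of the position vector in the Frenet frame *)
  destruct hfrenet as [heps hA hT hN hB1 hB2 gTT gNN gB1B1 gB2B2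
    gTN gTB1 gTB2 gNB1 gNB2 gB1B2 ck1 ck2 ck3].
  set (q := fun s => g (alpha s) (alpha s)).
  set (t := fun s => g (alpha s) (T s)).
  set (n := fun s => g (alpha s) (N s)).
  set (b1 := fun s => g (alpha s) (B1 s)).
  set (b2 := fun s => g (alpha s) (B2 s)).
  assert (dq : forall s, in_itv a b s -> is_derive q s (2 * t s)).
  { intros s Hs.
    apply (is_derive_eq _ _ _ _
      (is_derive_g _ _ _ _ _ (hA s Hs) (hA s Hs))).
    rewrite (g_sym (T s)); unfold t; ring. }
  assert (dt : forall s, in_itv a b s -> is_derive t s (1 + k1 s * n s)).
  { intros s Hs.
    apply (is_derive_eq _ _ _ _
      (is_derive_g _ _ _ _ _ (hA s Hs) (hT s Hs))).
    rewrite g_scal_r, gTT by trivial; reflexivity. }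
  assert (dn : forall s, in_itv a b s ->
    is_derive n s (- k1 s * t s + k2 s * b1 s)).
  { intros s Hs.
    apply (is_derive_eq _ _ _ _
      (is_derive_g _ _ _ _ _ (hA s Hs) (hN s Hs))).
    rewrite g_plus_r, !g_scal_r, gTN by trivial; unfold t, b1; ring. }
  assert (db1 : forall s, in_itv a b s ->
    is_derive b1 s (- eps * k2 s * n s + k3 s * b2 s)).
  { intros s Hs.
    apply (is_derive_eq _ _ _ _
      (is_derive_g _ _ _ _ _ (hA s Hs) (hB1 s Hs))).
    rewrite g_plus_r, !g_scal_r, gTB1 by trivial; unfold n, b2; ring. }
  assert (db2 : forall s, in_itv a b s -> is_derive b2 s (k3 s * b1 s)).
  { intros s Hs.
    apply (is_derive_eq _ _ _ _
      (is_derive_g _ _ _ _ _ (hA s Hs) (hB2 s Hs))).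
    rewrite g_scal_r, gTB2 by trivial; unfold b1; ring. }
  (* The sign undoes the absolute value in the pseudo-norm, so (i) is a statement about the
     differentiable function [q]. *)
  assert (Eq : forall s,
    sign (g (alpha s) (alpha s)) * pnorm (alpha s) ^ 2 = q s).
  { intros s; rewrite pnorm_sqr; apply sign_mult_abs. }
  (* The scalar square of the normal component; its derivative is
     [2 t - 2 t (1 + k1 n) = - 2 k1 t n]. *)
  set (h := fun s => q s - t s ^ 2).
  assert (Eh : forall s, in_itv a b s ->
    g (normal_component alpha T s) (normal_component alpha T s) = h s).
  { intros s Hs; now apply g_normal_component, gTT. }
  assert (dh : forall s, in_itv a b s ->
    is_derive h s (- 2 * k1 s * (t s * n s))).
  { intros s Hs; unfold h.
    eapply is_derive_eq.
    - apply @is_derive_minus; [apply dq, Hs | apply is_derive_pow, dt, Hs].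
    - unfold minus, plus, opp; simpl; ring. }
  split.

  (* Rectifying curves satisfy the four statements *)
  - intros Hrect _.
    assert (Hn : forall s, in_itv a b s -> n s = 0) by exact Hrect.
    assert (dt1 : forall s, in_itv a b s -> is_derive t s 1).
    { intros s Hs; apply (is_derive_eq _ _ _ _ (dt s Hs)).
      rewrite Hn by trivial; ring. }
    destruct (derivative_0_constant a b (fun s => t s - s) hab) as [c Hc].
    { intros s Hs; eapply is_derive_eq.
      - apply @is_derive_minus; [apply dt1, Hs | apply @is_derive_id].
      - unfold minus, plus, opp, one; simpl; ring. }
    assert (Ht : forall s, in_itv a b s -> t s = s + c).
    { intros s Hs; specialize (Hc s Hs); simpl in Hc; lra. }
    repeat split.
    (* Integrating [q' = 2 t = 2 s + 2 c] gives [c1 = 2 * c]. *)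
    + destruct (derivative_0_constant a b
        (fun s => q s - (s ^ 2 + 2 * c * s)) hab) as [c2 Hc2].
      { intros s Hs; eapply is_derive_eq.
        - apply @is_derive_minus; [apply dq, Hs |].
          apply (is_derive_Reals (fun s => s ^ 2 + 2 * c * s) s (2 * s + 2 * c)).
          auto_derive; trivial; ring.
        - rewrite (Ht s Hs); unfold minus, plus, opp; simpl; ring. }
      exists (2 * c), c2; intros s Hs; rewrite Eq.
      specialize (Hc2 s Hs); simpl in Hc2; lra.
    + now exists c.
    + apply constant_pnorm_iff.
      destruct (derivative_0_constant a b h hab) as [d Hd].
      { intros s Hs; apply (is_derive_eq _ _ _ _ (dh s Hs)).
        rewrite Hn by trivial; ring. }
      exists (Rabs d); intros s Hs; now rewrite Eh, Hd.
    (* A constant distance makes [Rabs q] constant, hence [q' = 2 t = 0] throughout, against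
       [t' = 1]. *)
    + intros Hconst; apply constant_pnorm_iff in Hconst.
      assert (Ht0 : forall s, in_itv a b s -> t s = 0).
      { intros s Hs.
        pose proof (derivative_0_of_constant_abs a b q _ dq Hconst s Hs).
        simpl in *; lra. }
      destruct (in_itv_nonempty _ _ hab) as [s Hs].
      assert (1 = 0); [| lra].
      apply (derivative_eq_on a b t (fun _ => 0) s); auto.
      apply @is_derive_const.
    + intros H0.
      set (th := RInt k3 0).
      assert (dth : forall s, in_itv a b s -> is_derive th s (k3 s)).
      { intros s Hs; now apply (is_derive_primitive a b). }
      assert (dch : forall s, in_itv a b s ->
        is_derive (fun u => cosh (th u)) s (k3 s * sinh (th s))).
      { intros s Hs; now apply is_derive_cosh_comp, dth. }
      assert (dsh : forall s, in_itv a b s ->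
        is_derive (fun u => sinh (th u)) s (k3 s * cosh (th s))).
      { intros s Hs; now apply is_derive_sinh_comp, dth. }
      (* With [n = 0] the system is [b1' = k3 b2], [b2' = k3 b1], whose flow is the hyperbolic
         rotation of angle [th]. Applying the inverse rotation to [(b1, b2)] yields the two
         constants [A] and [B]. *)
      destruct (derivative_0_constant a b
        (fun s => b1 s * cosh (th s) - b2 s * sinh (th s)) hab) as [A HA].
      { intros s Hs; eapply is_derive_eq.
        - apply @is_derive_minus.
          + exact (is_derive_mult _ _ _ _ _ (db1 s Hs) (dch s Hs) Rmult_comm).
          + exact (is_derive_mult _ _ _ _ _ (db2 s Hs) (dsh s Hs) Rmult_comm).
        - rewrite Hn by trivial.
          unfold minus, plus, opp, mult; simpl; unfold mult; simpl; ring. }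
      destruct (derivative_0_constant a b
        (fun s => b2 s * cosh (th s) - b1 s * sinh (th s)) hab) as [B HB].
      { intros s Hs; eapply is_derive_eq.
        - apply @is_derive_minus.
          + exact (is_derive_mult _ _ _ _ _ (db2 s Hs) (dch s Hs) Rmult_comm).
          + exact (is_derive_mult _ _ _ _ _ (db1 s Hs) (dsh s Hs) Rmult_comm).
        - rewrite Hn by trivial.
          unfold minus, plus, opp, mult; simpl; unfold mult; simpl; ring. }
      assert (heps2 : eps * eps = 1) by (destruct heps as [-> | ->]; ring).
      (* The extra [eps] cancels the factor in front of the formulas, since [eps * eps = 1]. *)
      exists (eps * A), (eps * B); intros s Hs.
      rewrite <- (HA s Hs), <- (HB s Hs).
      fold (th s) (b1 s) (b2 s).
      pose proof (cosh2_minus_sinh2 (th s)) as Hcs.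
      split.
      * transitivity (eps * eps * (cosh (th s) * cosh (th s)
          - sinh (th s) * sinh (th s)) * b1 s); [| ring].
        rewrite heps2, Hcs; ring.
      * transitivity (eps * eps * (cosh (th s) * cosh (th s)
          - sinh (th s) * sinh (th s)) * b2 s); [| ring].
        rewrite heps2, Hcs; ring.

  (* The converse: each statement forces [n = 0] *)
  - intros Hconv; split.
    2:{ intros s Hs; exists (T s); split; [auto |].
        left; rewrite gTT by trivial; lra. }
    assert (Hn_of_dt : forall s, in_itv a b s -> k1 s * n s = 0 -> n s = 0).
    { intros s Hs E; apply Rmult_integral in E as [E |]; trivial.
      now apply hk1 in E. }
    assert (Hn_of_t : tangential_formula a b alpha T ->
      forall s, in_itv a b s -> n s = 0).
    { intros [c Hc] s Hs; apply Hn_of_dt; trivial.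
      assert (1 + k1 s * n s = 1); [| lra].
      apply (derivative_eq_on a b t (fun s => s + c) s); auto.
      auto_derive; trivial; ring. }
    unfold rectifying; fold n.
    destruct Hconv as [Hi | [Hii | [[Hh Hrho] | [H0 Hiv]]]].
    + apply Hn_of_t.
      (* Differentiating (i) gives [2 t = 2 s + c1], which is (ii) with constant [c1 / 2]. *)
      destruct Hi as (c1 & c2 & Hq); exists (c1 / 2); intros s Hs.
      fold (t s).
      assert (2 * t s = 2 * s + c1); [| lra].
      apply (derivative_eq_on a b q (fun s => s ^ 2 + c1 * s + c2) s); auto.
      * intros u Hu; now rewrite <- Eq, Hq.
      * auto_derive; trivial; ring.
    + now apply Hn_of_t.
    + apply constant_pnorm_iff in Hh.
      assert (Htn : forall s, in_itv a b s -> t s * n s = 0).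
      { intros s Hs.
        assert (E : - 2 * k1 s * (t s * n s) = 0).
        { apply (derivative_0_of_constant_abs a b h
            (fun s => - 2 * k1 s * (t s * n s)) dh); trivial.
          destruct Hh as [d Hd]; exists d; intros u Hu.
          rewrite <- (Eh u Hu); now apply Hd. }
        apply Rmult_integral in E as [E |]; trivial.
        exfalso; apply (hk1 s Hs); lra. }
      assert (cn : forall s, in_itv a b s -> continuous n s).
      { intros s Hs; apply @ex_derive_continuous.
        eexists; now apply dn. }
      (* Where n <> 0, t vanishes nearby, so t' = 0; elsewhere t' = 1. *)
      assert (Hdt : forall s, in_itv a b s -> n s <> 0 ->
        1 + k1 s * n s = 0).
      { intros s Hs Hns.
        rewrite <- (is_derive_unique _ _ _ (dt s Hs)).
        apply is_derive_unique.
        apply (is_derive_ext_loc (fun _ => 0)); [| apply @is_derive_const].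
        assert (Hl : locally s (fun u => n u <> 0)).
        { apply (cn s Hs (fun y => y <> 0)).
          now apply open_neq. }
        apply (filter_imp (fun u => in_itv a b u /\ n u <> 0)).
        - intros u [Hu Hnu]; pose proof (Htn u Hu) as E.
          apply Rmult_integral in E as [E | E]; [easy | contradiction].
        - apply filter_and; trivial; now apply in_itv_open. }
      intros s Hs; destruct (Req_dec (n s) 0) as [| Hns]; trivial.
      exfalso; apply Hrho.
      (* The continuous function [1 + k1 n] is 1 at zeros of [n] and 0 elsewhere, hence constant.
         Being 0 at [s], it is 0 everywhere, so [n] has no zero. *)
      assert (Hn_ne : forall u, in_itv a b u -> n u <> 0).
      { intros u Hu Hnu.
        assert (E : 1 + k1 s * n s = 1 + k1 u * n u).
        { apply (continuous_boolean_constant a b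
            (fun v => 1 + k1 v * n v)); trivial.
          - intros v Hv; apply @continuous_plus; [apply continuous_const |].
            apply @continuous_mult; auto.
          - intros v Hv; destruct (Req_dec (n v) 0) as [E | E]; [right | auto].
            rewrite E; ring. }
        rewrite Hdt, Hnu in E by trivial; lra. }
      apply constant_pnorm_iff.
      (* Now [t n = 0] gives [t = 0] everywhere, so [q' = 2 t = 0] and the distance would be
         constant. *)
      destruct (derivative_0_constant a b q hab) as [d Hd].
      { intros u Hu; apply (is_derive_eq _ _ _ _ (dq u Hu)).
        pose proof (Htn u Hu) as E.
        apply Rmult_integral in E as [-> | E]; [ring |].
        now apply Hn_ne in E. }
      exists (Rabs d); intros u Hu; now rewrite <- (Hd u Hu).
    + destruct Hiv as (A & B & HAB).
      set (th := RInt k3 0) in HAB.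
      intros s Hs.
      pose proof (is_derive_primitive a b k3 s ck3 H0 Hs) as dth.
      (* The derivative of the formula for [b1] is [k3] times the formula for [b2]. Comparison with
         the Frenet derivative leaves [eps * k2 * n = 0], where [eps] and [k2] are non-zero. *)
      assert (E : - eps * k2 s * n s + k3 s * b2 s = k3 s * b2 s).
      { apply (derivative_eq_on a b b1
          (fun s => eps * (A * cosh (th s) + B * sinh (th s))) s); auto.
        - intros u Hu; now apply HAB.
        - eapply is_derive_eq.
          + apply @is_derive_scal, @is_derive_plus; apply @is_derive_scal.
            * apply is_derive_cosh_comp, dth.
            * apply is_derive_sinh_comp, dth.
          + unfold b2; rewrite (proj2 (HAB s Hs)); fold th.
            unfold plus; simpl; ring. }
      assert (E' : eps * (k2 s * n s) = 0) by lra.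
      apply Rmult_integral in E' as [E' | E'].
      { exfalso; destruct heps; lra. }
      apply Rmult_integral in E' as [E' |]; trivial.
      now apply hk2 in E'.
Qed.
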